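(* Let $\mathscr{F}$ be a free filter on $\mathbb{N}$ and let $F\in\mathscr{F}$ be a set with infinite complement $\mathbb{N}\setminus F$. Then the following assertions hold: (i) the closed subsemilattice $E=\left(\mathbb{N}_{\mathscr{F},\max}\times\{0\}\right)\cup\left((\mathbb{N}\setminus F)\times\{1\}\right)$ of the direct product $\mathbb{N}_{\mathscr{F},\max}\times E_2$ is $\mathscr{H}$-complete; (ii) the subset $I=\mathbb{N}_{\mathscr{F},\max}\times\{0\}$ is an open-and-closed ideal in $E$, and the quotient semilattice $E/I$ with the quotient topology is discrete and not $\mathscr{H}$-complete; (iii) the semilattice $E$ is not $\mathscr{AH}$-complete.
   Context: All topological spaces are assumed to be Hausdorff. $\mathbb{N}$ is the set of positive integers. A topological semigroup is a (Hausdorff) topological space with a continuous (jointly, as a map $S\times S\to S$) associative operation. A semilattice is a set with a commutative, idempotent, associative operation; a topological semilattice is a topological semigroup which is algebraically a semilattice. A topological semigroup $X$ is $\mathscr{H}$-complete if for every Hausdorff topological semigroup $Y$ and every homomorphism $f\colon X\to Y$ that is a topological embedding, $f(X)$ is closed in $Y$. $X$ is $\mathscr{AH}$-complete if for every Hausdorff topological semigroup $Y$ and every continuous homomorphism $f\colon X\to Y$, $f(X)$ is closed in $Y$. A (proper) filter $\mathscr{F}$ on $\mathbb{N}$ is free if $\bigcap\mathscr{F}=\varnothing$. For a free filter $\mathscr{F}$ on $\mathbb{N}$, $\mathbb{N}_{\mathscr{F}}=\mathbb{N}\cup\{\mathscr{F}\}$ is the topological space in which all points of $\mathbb{N}$ are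 isolated and the sets $F\cup\{\mathscr{F}\}$, $F\in\mathscr{F}$, form a neighbourhood base at the point $\mathscr{F}$. $\mathbb{N}_{\mathscr{F},\max}$ is the topological semilattice on this space whose operation extends $\max$ on $\mathbb{N}$ by $\max\{n,\mathscr{F}\}=\max\{\mathscr{F},n\}=\max\{\mathscr{F},\mathscr{F}\}=\mathscr{F}$ for $n\in\mathbb{N}$. $E_2=\{0,1\}$ is the discrete topological semilattice with operation $\min$. Direct products carry the coordinatewise operation and the product topology; subsemilattices carry the subspace topology. For an ideal $I$ of $E$ (that is, a nonempty set with $I\cdot E\subseteq I$), $E/I$ is the Rees quotient, obtained from $E$ by collapsing $I$ to a single point (the zero of $E/I$). *)

(* Defs.v *)
From HB Require Import structures.
From mathcomp Require Import all_boot all_classical all_analysis.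

Set Implicit Arguments.
Unset Strict Implicit.
Unset Printing Implicit Defensive.

Local Open Scope classical_set_scope.
Local Open Scope group_scope.

HB.mixin Record Semigroup_isSemilattice S of Semigroup S := {
  slmulC : commutative (@mul S) ;
  slmulgg : idempotent_op (@mul S)
}.

#[short(type="semilatticeType")]
HB.structure Definition Semilattice :=
  {S of Semigroup S & Semigroup_isSemilattice S}.

#[short(type="preTopologicalSemigroupType")]
HB.structure Definition PreTopologicalSemigroup :=
  {S of Topological S & Semigroup S}.

#[short(type="preTopologicalSemilatticeType")]
HB.structure Definition PreTopologicalSemilattice :=
  {S of Topological S & Semilattice S}.

(* All spaces are Hausdorff, so this is part of the structure. *)
HB.mixin Record PreTopologicalSemigroup_isTopologicalSemigroup S
    of PreTopologicalSemigroup S := {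
  semigroup_hausdorff : hausdorff_space S ;
  mulg_continuous : continuous (fun p : S * S => p.1 * p.2)
}.

#[short(type="topologicalSemigroupType")]
HB.structure Definition TopologicalSemigroup :=
  {S of PreTopologicalSemigroup S &
        PreTopologicalSemigroup_isTopologicalSemigroup S}.

#[short(type="topologicalSemilatticeType")]
HB.structure Definition TopologicalSemilattice :=
  {S of TopologicalSemigroup S & Semilattice S}.

Definition topological_embedding (X Y : topologicalType) (f : X -> Y) :=
  [/\ injective f, continuous f &
      forall U, open U -> exists2 V, open V & f @` U = range f `&` V].

(* Completeness is defined for every semigroup with a topology, so that it
   applies to a quotient not known a priori to be a topological semigroup;
   the codomain Y ranges over Hausdorff topological semigroups. *)
Definition H_complete (X : preTopologicalSemigroupType) :=
  forall (Y : topologicalSemigroupType) (f : {multiplicative X -> Y}),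
    topological_embedding f -> closed (range f).

Definition AH_complete (X : preTopologicalSemigroupType) :=
  forall (Y : topologicalSemigroupType) (f : {multiplicative X -> Y}),
    continuous f -> closed (range f).

Definition is_ideal (S : semigroupType) (I : set S) :=
  I !=set0 /\ forall x y, I x -> I (x * y).

Definition discrete (X : topologicalType) := forall U : set X, open U.

Lemma cluster_continuous (X Y : topologicalType) (f : X -> Y) (p q : X) :
  continuous f -> cluster (nbhs p) q -> cluster (nbhs (f p)) (f q).
Proof.
move=> cf cpq A B /cf pA /cf qB.
by have [x [Ax Bx]] := cpq _ _ pA qB; exists (f x).
Qed.

Section ProductSemilattice.
Variables L M : topologicalSemilatticeType.

Fact prod_slmulC : commutative (@mul (L * M)%type).
Proof. by move=> [a b] [c d]; congr pair; apply: slmulC. Qed.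

Fact prod_slmulgg : idempotent_op (@mul (L * M)%type).
Proof. by move=> [a b]; congr pair; apply: slmulgg. Qed.

HB.instance Definition _ :=
  Semigroup_isSemilattice.Build (L * M)%type prod_slmulC prod_slmulgg.

Fact prod_semigroup_hausdorff : hausdorff_space (L * M)%type.
Proof.
move=> p q cpq; rewrite (surjective_pairing p) (surjective_pairing q).
congr pair; apply: semigroup_hausdorff.
- by apply: cluster_continuous cpq => x; exact: cvg_fst.
- by apply: cluster_continuous cpq => x; exact: cvg_snd.
Qed.

Fact prod_mulg_continuous :
  continuous (fun p : (L * M) * (L * M) => p.1 * p.2).
Proof.
have cL : continuous (fun p : (L * M) * (L * M) => p.1.1 * p.2.1).
  move=> p; apply: (@continuous_comp _ _ _
    (fun p : (L * M) * (L * M) => (p.1.1, p.2.1)) (fun q : L * L => q.1 * q.2)).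
    apply: cvg_pair.
  + by apply: cvg_comp; [exact: cvg_fst|exact: cvg_fst].
  + by apply: cvg_comp; [exact: cvg_snd|exact: cvg_fst].
  exact: mulg_continuous.
have cM : continuous (fun p : (L * M) * (L * M) => p.1.2 * p.2.2).
  move=> p; apply: (@continuous_comp _ _ _
    (fun p : (L * M) * (L * M) => (p.1.2, p.2.2)) (fun q : M * M => q.1 * q.2)).
    apply: cvg_pair.
  + by apply: cvg_comp; [exact: cvg_fst|exact: cvg_snd].
  + by apply: cvg_comp; [exact: cvg_snd|exact: cvg_snd].
  exact: mulg_continuous.
by move=> p; apply: cvg_pair; [exact: cL|exact: cM].
Qed.

HB.instance Definition _ :=
  PreTopologicalSemigroup_isTopologicalSemigroup.Build (L * M)%type
    prod_semigroup_hausdorff prod_mulg_continuous.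
End ProductSemilattice.

Record subsemilattice (L : semilatticeType) := Subsemilattice {
  subsemilattice_set :> set L ;
  subsemilatticeM : forall x y : L, subsemilattice_set x ->
    subsemilattice_set y -> subsemilattice_set (x * y)
}.

Definition subsemilattice_type (L : semilatticeType) (A : subsemilattice L) :
  Type := set_type A.

Section SubSemilattice.
Variables (L : topologicalSemilatticeType) (A : subsemilattice L).
Local Notation T := (subsemilattice_type A).

HB.instance Definition _ := Topological.copy T (set_type A).

Definition sub_mul (x y : T) : T :=
  SigSub (mem_set (subsemilatticeM (set_mem (valP x)) (set_mem (valP y)))).

Fact sub_mulgA : associative sub_mul.
Proof. by move=> x y z; apply: val_inj; exact: mulgA. Qed.

HB.instance Definition _ := isSemigroup.Build T sub_mulgA.

Fact sub_slmulC : commutative (@mul T).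
Proof. by move=> x y; apply: val_inj; exact: slmulC. Qed.

Fact sub_slmulgg : idempotent_op (@mul T).
Proof. by move=> x; apply: val_inj; exact: slmulgg. Qed.

HB.instance Definition _ :=
  Semigroup_isSemilattice.Build T sub_slmulC sub_slmulgg.

Fact sub_val_continuous : continuous (\val : T -> L).
Proof. exact: (@initial_continuous T L \val). Qed.

Fact sub_semigroup_hausdorff : hausdorff_space T.
Proof.
move=> p q cpq; apply: val_inj; apply: semigroup_hausdorff.
exact: cluster_continuous sub_val_continuous cpq.
Qed.

Fact sub_mulg_continuous : continuous (fun p : T * T => p.1 * p.2).
Proof.
apply: (@continuous_comp_initial _ _ _ (\val : T -> L)) => p.
apply: (@continuous_comp _ _ _
  (fun p : T * T => (\val p.1, \val p.2)) (fun q : L * L => q.1 * q.2)).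
  apply: cvg_pair.
  + by apply: cvg_comp; [exact: cvg_fst|exact: sub_val_continuous].
  + by apply: cvg_comp; [exact: cvg_snd|exact: sub_val_continuous].
exact: mulg_continuous.
Qed.

HB.instance Definition _ :=
  PreTopologicalSemigroup_isTopologicalSemigroup.Build T
    sub_semigroup_hausdorff sub_mulg_continuous.
End SubSemilattice.

Section ReesQuotient.
Local Open Scope quotient_scope.
Variables (L : preTopologicalSemilatticeType) (I : set L).

Definition rees_rel (x y : L) : bool := `[< x = y \/ I x /\ I y >].

Fact rees_refl : reflexive rees_rel.
Proof. by move=> x; apply/asboolP; left. Qed.

Fact rees_sym : symmetric rees_rel.
Proof.
by move=> x y; apply/asboolP/asboolP => -[->|[]]; by [left|right].
Qed.

Fact rees_trans : transitive rees_rel.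
Proof.
move=> y x z /asboolP [->//|[Ix Iy]] /asboolP [<-|[_ Iz]]; apply/asboolP;
  by right.
Qed.

Canonical rees_equiv := EquivRel rees_rel rees_refl rees_sym rees_trans.

Definition rees_quotient (hI : is_ideal I) : Type :=
  quotient_topology {eq_quot rees_equiv}.

Variable hI : is_ideal I.
Local Notation Q := (rees_quotient hI).

HB.instance Definition _ := Topological.copy Q
  (quotient_topology {eq_quot rees_equiv}).
HB.instance Definition _ := Quotient.copy Q
  (quotient_topology {eq_quot rees_equiv}).

Definition rees_mul (x y : Q) : Q := \pi_Q (repr x * repr y).

Lemma rees_piP (x y : L) :
  \pi_Q x = \pi_Q y <-> x = y \/ I x /\ I y.
Proof.
have E := @eqquotP _ _ {eq_quot rees_equiv} x y.
split; first by move=> /E /asboolP.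
by move=> h; apply/E/asboolP.
Qed.

Lemma rees_pi_mul (x y : L) : rees_mul (\pi_Q x) (\pi_Q y) = \pi_Q (x * y).
Proof.
have idealr a b : I b -> I (a * b) by rewrite slmulC; case: hI => _; apply.
have ideall a b : I a -> I (a * b) by case: hI => _; apply.
apply/rees_piP.
have /rees_piP [->|[Ia Ix]] := reprK (\pi_Q x); last first.
  by right; split; exact: ideall.
have /rees_piP [->|[Ib Iy]] := reprK (\pi_Q y); first by left.
by right; split; exact: idealr.
Qed.

Fact rees_mulgA : associative rees_mul.
Proof.
move=> x y z; rewrite -[x]reprK -[y]reprK -[z]reprK.
by rewrite (rees_pi_mul (repr y)) !(rees_pi_mul (repr x)) rees_pi_mul mulgA.
Qed.

HB.instance Definition _ := isSemigroup.Build Q rees_mulgA.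

Fact rees_slmulC : commutative (@mul Q).
Proof.
move=> x y; rewrite -[x]reprK -[y]reprK /mul /= !rees_pi_mul.
by rewrite slmulC.
Qed.

Fact rees_slmulgg : idempotent_op (@mul Q).
Proof. by move=> x; rewrite -[x]reprK /mul /= rees_pi_mul slmulgg. Qed.

HB.instance Definition _ :=
  Semigroup_isSemilattice.Build Q rees_slmulC rees_slmulgg.
End ReesQuotient.

Definition posnat := {n : nat | (0 < n)%N}.

Fact maxp_subproof (m n : posnat) : (0 < maxn (val m) (val n))%N.
Proof. by rewrite leq_max (valP m). Qed.

Definition maxp (m n : posnat) : posnat :=
  exist _ (maxn (val m) (val n)) (maxp_subproof m n).

Record free_filter (T : Type) := FreeFilter {
  free_pfilter :> pfilter_on T ;
  free_filterP : \bigcap_(A in (free_pfilter : set_system T)) A = set0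
}.

(* The point None is the point at infinity, i.e. the filter FF itself. *)
Definition Nmax (FF : free_filter posnat) : Type := option posnat.

Section Nmax.
Variable FF : free_filter posnat.
Local Notation N := (Nmax FF).

HB.instance Definition _ := Choice.copy N (option posnat).

Definition Nmax_nbhs (x : N) : set_system N :=
  if x is Some n then principal_filter (Some n : N)
  else filter_from FF (fun F => (Some @` F) `|` [set None]).

HB.instance Definition _ := hasNbhs.Build N Nmax_nbhs.

Lemma nbhs_NmaxN (U : set N) :
  nbhs (None : N) U <-> U None /\ FF (Some @^-1` U).
Proof.
split=> [[F FFF FU]|[UN FU]].
  split; first by apply: FU; right.
  by apply: filterS FFF => n Fn; apply: FU; left; exists n.
by exists (Some @^-1` U) => // _ [[n Un <-]|->].
Qed.

Lemma nbhs_NmaxS (n : posnat) (U : set N) :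
  nbhs (Some n : N) U <-> U (Some n).
Proof. by split=> [/principal_filterP|?]; [|apply/principal_filterP]. Qed.

Fact Nmax_nbhs_filter (x : N) : ProperFilter (nbhs x).
Proof.
case: x => [n|]; first exact: principal_filter_proper.
split; first by move=> /nbhs_NmaxN[].
split.
- by apply/nbhs_NmaxN; split => //; exact: filterT.
- move=> A B /nbhs_NmaxN[A0 FA] /nbhs_NmaxN[B0 FB]; apply/nbhs_NmaxN.
  by split => //; exact: filterI.
- move=> A B AB /nbhs_NmaxN[A0 FA]; apply/nbhs_NmaxN.
  by split; [exact: AB|apply: filterS FA => n; exact: AB].
Qed.

Fact Nmax_nbhs_singleton (x : N) (A : set N) : nbhs x A -> A x.
Proof. by case: x => [n /nbhs_NmaxS//|/nbhs_NmaxN[]]. Qed.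

Fact Nmax_nbhs_nbhs (x : N) (A : set N) : nbhs x A -> nbhs x (nbhs^~ A).
Proof.
case: x => [n /nbhs_NmaxS An|AN]; first by apply/nbhs_NmaxS/nbhs_NmaxS.
have [_ FA] := (nbhs_NmaxN A).1 AN; apply/nbhs_NmaxN; split => //.
by apply: filterS FA => n An; apply/nbhs_NmaxS.
Qed.

HB.instance Definition _ := Nbhs_isNbhsTopological.Build N
  Nmax_nbhs_filter Nmax_nbhs_singleton Nmax_nbhs_nbhs.

Definition Nmax_mul (x y : N) : N :=
  if x is Some m then if y is Some n then Some (maxp m n) else None else None.

Fact Nmax_mulgA : associative Nmax_mul.
Proof.
case=> [m|] [n|] [p|] //=; congr Some; apply: val_inj; exact: maxnA.
Qed.

HB.instance Definition _ := isSemigroup.Build N Nmax_mulgA.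

Fact Nmax_slmulC : commutative (@mul N).
Proof. case=> [m|] [n|] //=; congr Some; apply: val_inj; exact: maxnC. Qed.

Fact Nmax_slmulgg : idempotent_op (@mul N).
Proof. case=> [m|] //=; congr Some; apply: val_inj; exact: maxnn. Qed.

HB.instance Definition _ :=
  Semigroup_isSemilattice.Build N Nmax_slmulC Nmax_slmulgg.

Lemma free_filter_neq (n : posnat) : FF [set k | k <> n].
Proof.
have : ~ (\bigcap_(A in FF) A) n by rewrite free_filterP.
rewrite /bigcap /= => /existsNP[G /not_implyP[FG nGn]].
by apply: filterS FG => k Gk kn; apply: nGn; rewrite -kn.
Qed.

Lemma free_filter_gt (n : nat) : FF [set k | (n < val k)%N].
Proof.
elim: n => [|n IH]; first by apply: filterS filterT => k _; exact: valP.
have n0 : (0 < n.+1)%N by [].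
apply: filterS2 IH (free_filter_neq (exist _ n.+1 n0)) => k /= nk kn.
rewrite ltn_neqAle nk andbT; apply/eqP => e.
by apply: kn; apply: val_inj.
Qed.

Fact Nmax_hausdorff : hausdorff_space N.
Proof.
have sep n : ~ ((nbhs (None : N)) [set x | x <> Some n] -> False).
  apply; apply/nbhs_NmaxN; split => //.
  by apply: filterS (free_filter_neq n) => k kn [].
have nS n : nbhs (Some n : N) [set (Some n : N)] by apply/nbhs_NmaxS.
case=> [m|] [n|] //= c.
- by have [x [-> ]] := c _ _ (nS m) (nS n).
- by exfalso; apply: (sep m) => h; have [x []] := c _ _ (nS m) h.
- by exfalso; apply: (sep n) => h; have [x []] := c _ _ h (nS n).
Qed.

Fact Nmax_mulg_continuous : continuous (fun p : N * N => p.1 * p.2).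
Proof.
have key (m : posnat) (U : set N) : nbhs (None : N) U ->
    nbhs (None : N) [set x | U ((Some m : N) * x)].
  move=> /nbhs_NmaxN[UN FU]; apply/nbhs_NmaxN; split => //.
  apply: filterS2 FU (free_filter_gt (val m)) => k Uk mk.
  rewrite /mul /= (_ : maxp m k = k)//.
  by apply: val_inj; exact/maxn_idPr/ltnW.
have nS n : nbhs (Some n : N) [set (Some n : N)] by apply/nbhs_NmaxS.
case=> [[m|] [n|]] U /= hU.
- exists ([set (Some m : N)], [set (Some n : N)]) => //= -[a b] /= [-> ->].
  exact: nbhs_singleton.
- exists ([set (Some m : N)], [set x | U ((Some m : N) * x)]).
    by split => //=; exact: key.
  by move=> [a b] /= [-> ].
- exists ([set x | U ((Some n : N) * x)], [set (Some n : N)]).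
    by split => //=; exact: key.
  by move=> [a b] /= [+ ->]; rewrite slmulC.
- have UN : U None := nbhs_singleton hU.
  exists (U, U) => //= -[[a|] [b|]] /= [Ua Ub]; try exact: UN.
  rewrite /mul /=; have [ab|ba] := leqP (val a) (val b).
  + by rewrite (_ : maxp a b = b)//; apply: val_inj; exact/maxn_idPr.
  + by rewrite (_ : maxp a b = a)//; apply: val_inj; exact/maxn_idPl/ltnW.
Qed.

HB.instance Definition _ :=
  PreTopologicalSemigroup_isTopologicalSemigroup.Build N
    Nmax_hausdorff Nmax_mulg_continuous.
End Nmax.

(* false stands for 0 and true for 1, so that min is andb. *)
Definition E2 : Type := bool.
HB.instance Definition _ := DiscreteTopology.copy E2 bool.
HB.instance Definition _ := isSemigroup.Build E2 andbA.
HB.instance Definition _ := Semigroup_isSemilattice.Build E2 andbC andbb.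

Fact E2_hausdorff : hausdorff_space E2.
Proof. exact: discrete_hausdorff. Qed.

Fact E2_mulg_continuous : continuous (fun p : E2 * E2 => p.1 * p.2).
Proof.
move=> [a b] U /= hU.
exists ([set a], [set b]); first by split; exact: discrete_set1.
by move=> [c d] /= [-> ->]; exact: nbhs_singleton hU.
Qed.

HB.instance Definition _ :=
  PreTopologicalSemigroup_isTopologicalSemigroup.Build E2
    E2_hausdorff E2_mulg_continuous.

Section E.
Variables (FF : free_filter posnat) (F : set posnat).
Local Notation P := (Nmax FF * E2)%type.

Definition E_set : set P :=
  ([set: Nmax FF] `*` [set false]) `|` ((Some @` (~` F)) `*` [set true]).

Fact E_setM (x y : P) : E_set x -> E_set y -> E_set (x * y).
Proof.
move=> [[_ /= x2]|[[m Fm x1] /= x2]] [[_ /= y2]|[[n Fn y1] /= y2]].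
- by left; split => //=; rewrite /mul /= x2.
- by left; split => //=; rewrite /mul /= x2.
- by left; split => //=; rewrite /mul /= x2 y2.
right; split; last by rewrite /= /mul /= x2 y2.
rewrite /= /mul /= -x1 -y1 /mul /=.
have [ab|ba] := leqP (val m) (val n).
- by exists n => //; congr Some; apply: val_inj; exact/esym/maxn_idPr.
- by exists m => //; congr Some; apply: val_inj; exact/esym/maxn_idPl/ltnW.
Qed.

Definition E : subsemilattice P := Subsemilattice E_setM.

Definition I_set : set (subsemilattice_type E) :=
  \val @^-1` ([set: Nmax FF] `*` [set false]).
End E.
Arguments E_set : clear implicits.
Arguments E : clear implicits.
Arguments I_set : clear implicits.

(* Main.v *)
(* For (i), let f embed E into Y and let y be a point of the closure of f(E)
   outside f(E). All but finitely many x in E satisfy x (n,0) = x (1,0), so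
   y f(n,0) does not depend on n; letting n tend to the filter gives
   y f(1,0) = y f(oo,0) = f(oo,0). The points of E near (oo,0) have first
   coordinate in F or infinite, hence no f(n,1) with n outside F is near y, and
   y is in the closure of f(N x {0}). On that set multiplication by f(1,0) is
   the identity, so y = f(oo,0), a contradiction.
   For (ii) and (iii), let G be the Frechet filter. The map sending (a,0) to
   (oo,0) and (n,1) to (n,1) is a continuous homomorphism from E to the product
   of N_(G,max) and E_2; it induces an embedding of E/I, and its range misses
   its limit point (oo,1). *)
From HB Require Import structures.
Require Import Defs.
From mathcomp Require Import all_boot all_classical all_analysis.

Set Implicit Arguments.
Unset Strict Implicit.
Unset Printing Implicit Defensive.

Local Open Scope classical_set_scope.
Local Open Scope group_scope.

(** * Identities that pass to closures, and continuity of translations *)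

Lemma eq_on_closure (T Y : topologicalType) (A : set T) (f g : T -> Y) :
  hausdorff_space Y -> continuous f -> continuous g ->
  (forall x, A x -> f x = g x) -> forall x, closure A x -> f x = g x.
Proof.
move=> hY cf cg fg x clx; apply: hY => U V fU gV.
have xU : nbhs x (f @^-1` U) by exact: cf.
have xV : nbhs x (g @^-1` V) by exact: cg.
have [z [Az [Uz Vz]]] := clx _ (filterI xU xV).
by exists (f z); split => //; rewrite fg.
Qed.

(** Finite sets are closed in a Hausdorff space. This lets an identity that holds on [A] up to
    finitely many exceptions reach the limit point [x]. *)
Lemma closure_setD_finite (T : topologicalType) (A B : set T) (x : T) :
  hausdorff_space T -> finite_set B -> ~ B x ->
  closure A x -> closure (A `\` B) x.
Proof.
move=> hT finB nBx clx U xU.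
have cB : closed B.
  exact: (accessible_finite_set_closed.1 (hausdorff_accessible hT)).
have nB : nbhs x (~` B).
  by apply: open_nbhs_nbhs; split => //; exact: closed_openC.
by have [z [Az [Uz nBz]]] := clx _ (filterI xU nB); exists z.
Qed.

Lemma mulg_continuousl (Y : topologicalSemigroupType) (a : Y) :
  continuous (fun z : Y => a * z).
Proof.
move=> z; apply: (@continuous_comp _ _ _ (fun z : Y => (a, z))
  (fun q : Y * Y => q.1 * q.2)); last exact: mulg_continuous.
by apply: cvg_pair; [exact: cvg_cst|exact: cvg_id].
Qed.

Lemma mulg_continuousr (Y : topologicalSemigroupType) (a : Y) :
  continuous (fun z : Y => z * a).
Proof.
move=> z; apply: (@continuous_comp _ _ _ (fun z : Y => (z, a))
  (fun q : Y * Y => q.1 * q.2)); last exact: mulg_continuous.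
by apply: cvg_pair; [exact: cvg_id|exact: cvg_cst].
Qed.

(** * Positive integers, isolated points and the Frechet filter *)

Definition posnat1 : posnat := exist _ 1%N isT.

Lemma maxp_idr (m n : posnat) : (val m <= val n)%N -> maxp m n = n.
Proof. by move=> mn; apply: val_inj; exact/maxn_idPr. Qed.

Lemma maxp_idl (m n : posnat) : (val n <= val m)%N -> maxp m n = m.
Proof. by move=> nm; apply: val_inj; exact/maxn_idPl. Qed.

Lemma nbhs_E2 (b : E2) : nbhs b [set b].
Proof. exact: (@discrete_set1 bool). Qed.

Lemma nbhs_NmaxE2S (FF : free_filter posnat) (n : posnat) (b : E2) :
  nbhs ((Some n, b) : Nmax FF * E2) [set ((Some n, b) : Nmax FF * E2)].
Proof.
exists ([set (Some n : Nmax FF)], [set b]).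
  by split; [exact/nbhs_NmaxS|exact: nbhs_E2].
by move=> [c d] /= [-> ->].
Qed.

Lemma infinite_posnat : infinite_set [set: posnat].
Proof.
move=> fin; apply: infinite_nat.
pose s n : posnat := exist _ n.+1 isT.
have inj : {in s @^-1` [set: posnat] &, injective s} by move=> m n _ _ [].
exact: finite_preimage inj fin.
Qed.

Lemma frechet_filter_free :
  \bigcap_(A in @frechet_filter posnat) A = set0.
Proof.
rewrite -subset0 => n /(_ (~` [set n])); apply => //.
by rewrite /frechet_filter /= setCK; exact: finite_set1.
Qed.

Definition frechet_free_filter : free_filter posnat :=
  @FreeFilter _
    (PFilterPack _ (frechet_properfilter infinite_posnat)) frechet_filter_free.

(** * The two layers of E *)

Section SemilatticeE.
Variables (FF : free_filter posnat) (F : set posnat).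
Local Notation N := (Nmax FF).
Local Notation P := (N * E2)%type.
Local Notation T := (subsemilattice_type (E FF F)).

(** Points (n,1) are isolated in the product, and (oo,1) has the neighbourhood (F with oo) x {1},
    which misses E because the upper layer of E lies over the complement of [F]. *)
Lemma E_set_closed : FF F -> closed (E_set FF F).
Proof.
move=> FFF [a b] cl; case: b cl => cl; last by left.
right; split => //=; case: a cl => [n|] cl.
  have [z [Ez zn]] := cl _ (nbhs_NmaxE2S FF n true).
  by move: Ez; rewrite zn => -[[]|[]].
have V : nbhs ((None, true) : P)
    (((Some @` F) `|` [set None]) `*` [set true]).
  exists ((Some @` F) `|` [set None], [set true]) => //.
  by split; [exists F|exact: nbhs_E2].
have [[c d] /= [Ecd [/= cF dt]]] := cl _ V; rewrite dt in Ecd.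
case: Ecd => [[]//|[[n nF /= nc] _]]; rewrite -nc in cF.
by case: cF => // -[m mF [mn]]; case: nF; rewrite -mn.
Qed.

Definition E_low (a : N) : T :=
  SigSub (mem_set (or_introl (conj Logic.I erefl) : E_set FF F (a, false))).

Lemma E_lowP (x : T) : (\val x : P).2 = false -> x = E_low (\val x : P).1.
Proof. by move=> x2; apply: val_inj; rewrite [LHS]surjective_pairing x2. Qed.

Lemma mul_E_low (x : T) (b : N) :
  x * E_low b = E_low (Nmax_mul (\val x : P).1 b).
Proof. by apply: val_inj; congr pair; exact: andbF. Qed.

Lemma E_highP (x : T) : (\val x : P).2 = true ->
  exists2 n, ~ F n & \val x = (Some n, true) :> P.
Proof.
have := set_mem (valP x); case: (\val x) => a b /= + b1; rewrite b1.
by case=> [[]//|[[n nF /= <-] _]]; exists n.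
Qed.

Lemma nbhs_E_val (x : T) (A : set P) :
  nbhs (\val x : P) A -> nbhs x [set y : T | A (\val y)].
Proof. by move=> xA; exact: (@sub_val_continuous _ (E FF F) x A xA). Qed.

Lemma E_low_continuous : continuous E_low.
Proof.
apply: (@continuous_comp_initial _ _ _ (\val : T -> P)) => a.
move=> U [[A B] /= [aA fB] ABU]; apply: filterS aA => b Ab; apply: ABU.
by split => //; exact: nbhs_singleton fB.
Qed.

Lemma Nmax_closure_range_Some : closure (range (Some : posnat -> N)) None.
Proof.
move=> U /nbhs_NmaxN[_ FU]; have [n Un] := filter_ex FU.
by exists (Some n); split => //; exists n.
Qed.

(** Only at these points can multiplication by (n,0) differ from multiplication by (1,0). *)
Lemma E_small_finite (n : nat) :
  finite_set [set x : T | exists2 k, (\val x : P).1 = Some k & (val k < n)%N].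
Proof.
have fin : finite_set ((Some @` [set k : posnat | (val k < n)%N])
    `*` [set: E2] : set P).
  apply: finite_setX; last exact: (@finite_finset bool).
  apply: finite_image.
  apply: (@finite_preimage _ _ `I_n (val : posnat -> nat)) => //.
  by move=> ? ? _ _; exact: val_inj.
have inj : {in (\val : T -> P) @^-1`
    ((Some @` [set k | (val k < n)%N]) `*` [set: E2]) &,
    injective (\val : T -> P)} by move=> ? ? _ _; exact: val_inj.
apply: sub_finite_set (finite_preimage inj fin) => x [k xk kn].
by split => //; exists k.
Qed.

(** * H-completeness of E *)

Lemma E_H_complete : FF F -> H_complete T.
Proof.
move=> FFF Y f [injf cf embf] y cly; apply: contrapT => nfy.
pose e a := f (E_low a).
have hY : hausdorff_space Y := semigroup_hausdorff.
have ce : continuous e.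
  by move=> a; apply: continuous_comp; [exact: E_low_continuous|exact: cf].
have y_e n : y * e (Some n) = y * e (Some posnat1).
  (* [B] collects the exceptional values. For any other point the first coordinate is oo or some k
     >= n, and then max(k,n) = k = max(k,1). *)
  pose B := f @` [set x : T |
    exists2 k, (\val x : P).1 = Some k & (val k < val n)%N].
  have finB : finite_set B by apply: finite_image; exact: E_small_finite.
  have nB : ~ B y by move=> [x _ xy]; apply: nfy; exists x.
  apply: (eq_on_closure (f := fun z => z * e (Some n))
    (g := fun z => z * e (Some posnat1))
    hY (@mulg_continuousr _ _) (@mulg_continuousr _ _) _
    (closure_setD_finite hY finB nB cly)).
  move=> _ [[x _ <-] nBx]; rewrite /e -!gmulfM; congr (f _).
  rewrite !mul_E_low; congr E_low.
  case xE : (\val x : P).1 => [k|//]; rewrite /Nmax_mul.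
  have nk : (val n <= val k)%N.
    by rewrite leqNgt; apply/negP => kn; apply: nBx; exists x => //; exists k.
  by rewrite !maxp_idl//; exact: (valP k).
have y_einf : y * e None = e None.
  apply: (eq_on_closure (f := fun z => z * e None) (g := fun=> e None)
    hY (@mulg_continuousr _ _) (@cst_continuous _ _ _) _ cly).
  move=> _ [x _ <-]; rewrite /e -gmulfM; congr (f _).
  by rewrite mul_E_low; case: (_ : P).1.
have y_e1 : y * e (Some posnat1) = e None.
  rewrite -y_einf; symmetry.
  apply: (eq_on_closure (f := fun a => y * e a)
    (g := fun=> y * e (Some posnat1)) hY _ (@cst_continuous _ _ _) _ Nmax_closure_range_Some).
    by move=> a; exact: (@continuous_comp _ _ _ e (fun z => y * z)
      a (ce a) (@mulg_continuousl Y y (e a))).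
  by move=> _ [n _ <-]; exact: y_e.
have y_low : closure (range e) y.
  (* [W] has no point over the complement of [F], and it is a neighbourhood of (oo,0) because [F]
     belongs to the filter. *)
  pose W : set T := [set x | forall n, (\val x : P).1 = Some n -> F n].
  have nW : nbhs (E_low None) W.
    apply: (@nbhs_E_val _ [set p : P | forall n, p.1 = Some n -> F n]).
    exists ([set a : N | forall n, a = Some n -> F n], [set false]).
      split; last exact: nbhs_E2.
      by apply/nbhs_NmaxN; split => //; apply: filterS FFF => n Fn _ [<-].
    by move=> [a b] /= [].
  have [V oV fV] := embf _ (open_interior W).
  have Ve : V (e None).
    have : (f @` W°) (e None) by exists (E_low None).
    by rewrite fV => -[].
  move=> U yU.
  (* Since [y * e (Some posnat1)] equals [e None], which lies in [V], multiplication by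
     [e (Some posnat1)] sends points near [y] into [V]. *)
  have yV : nbhs y [set z | V (z * e (Some posnat1))].
    apply: mulg_continuousr; rewrite y_e1.
    by apply: open_nbhs_nbhs.
  have [_ [[x _ <-] [Ufx Vfx]]] := cly _ (filterI yU yV).
  exists (f x); split => //.
  case xb : ((\val x : P).2); last first.
    by exists (\val x : P).1 => //; rewrite /e -E_lowP.
  have [n nF xn] := E_highP xb; exfalso; apply: nF.
  (* The product of x = (n,1) with (1,0) is (n,0). Its image lies in [V], so (n,0) is in [W], which
     forces n into [F]. *)
  have : (range f `&` V) (f (x * E_low (Some posnat1))).
    by split; [exists (x * E_low (Some posnat1))|rewrite gmulfM].
  rewrite -fV => -[z /interior_subset zF /injf zE]; apply: zF.
  by rewrite zE mul_E_low xn /= maxp_idl//; exact: (valP n).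
have yy : y * e (Some posnat1) = y.
  apply: (eq_on_closure (f := fun z => z * e (Some posnat1)) (g := id)
    hY (@mulg_continuousr _ _) (fun=> cvg_id) _ y_low).
  move=> _ [a _ <-]; rewrite /e -gmulfM; congr (f _).
  rewrite mul_E_low; congr E_low.
  by case: a => [n|//]; rewrite /= maxp_idl//; exact: (valP n).
by apply: nfy; exists (E_low None) => //; rewrite -/(e None) -y_e1.
Qed.

(** * The ideal I and its Rees quotient *)

(** Points of the upper layer are isolated, and I is a neighbourhood of each of its points; hence a
    set that contains I or misses it is open. *)
Lemma E_open (W : set T) :
  (forall x y, I_set FF F x -> I_set FF F y -> W x -> W y) -> open W.
Proof.
move=> satW; rewrite openE => x Wx; rewrite /interior.
case xb : ((\val x : P).2).
  have [n _ xn] := E_highP xb.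
  have nx : nbhs (\val x : P) [set \val x : P].
    by rewrite xn; exact: nbhs_NmaxE2S.
  by apply: filterS (nbhs_E_val nx) => y /val_inj ->.
have nx : nbhs (\val x : P) ([set: N] `*` [set false]).
  exists ([set: N], [set false]) => //.
  by split; [exact: filterT|rewrite xb; exact: nbhs_E2].
apply: filterS (nbhs_E_val nx) => y Iy.
by apply: satW Wx => //; split.
Qed.

Lemma I_set_clopen : clopen (I_set FF F).
Proof.
split; first exact: E_open.
rewrite -[I_set FF F]setCK; apply: open_closedC; apply: E_open => x y Ix _ nIx.
by case: (nIx Ix).
Qed.

Lemma I_set_ideal : is_ideal (I_set FF F).
Proof.
split; first by exists (E_low None).
by move=> x y [_ /= x0]; split => //=; rewrite /mul /= /mul /= x0.
Qed.

(** The preimage of any set under the projection contains I or misses it. *)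
Lemma rees_E_discrete (hI : is_ideal (I_set FF F)) :
  discrete (rees_quotient hI).
Proof.
move=> U; apply: E_open => x y Ix Iy /=.
by have -> : \pi_(rees_quotient hI)%qT y = \pi_(rees_quotient hI)%qT x
  by apply/rees_piP; right.
Qed.

(** * The collapsing homomorphism and the failures of completeness *)

Local Notation Y := (Nmax frechet_free_filter * E2)%type.

(** The Frechet filter replaces [FF] in the target so that every infinite set of integers
    accumulates at oo. The value (oo,0) on I is the zero of [Y]. *)
Definition collapse (x : T) : Y :=
  if (\val x : P).2 then ((\val x : P).1, true) else (None, false).

Lemma collapseM : {morph collapse : x y / x * y}.
Proof.
move=> x y; rewrite /collapse.
have -> : (\val (x * y) : P).2 = (\val x : P).2 && (\val y : P).2 by [].
case: ((\val x : P).2); case: ((\val y : P).2) => //=.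
by congr pair; case: ((\val x : P).1).
Qed.

(** This makes the map induced on E/I well defined and injective. *)
Lemma collapse_eq (x y : T) :
  collapse x = collapse y <-> x = y \/ I_set FF F x /\ I_set FF F y.
Proof.
split=> [|[->//|[[_ /= x0] [_ /= y0]]]]; last by rewrite /collapse x0 y0.
rewrite /collapse; case xb : ((\val x : P).2); case yb : ((\val y : P).2) => //.
  case=> xy; left; apply: val_inj.
  by rewrite [LHS]surjective_pairing [RHS]surjective_pairing xy xb yb.
by right.
Qed.

(** A cofinite set meets the infinite complement of [F], so (oo,1) is a limit of points (n,1) of the
    range. It is not a value, since upper points of E have finite first coordinate. *)
Lemma collapse_range_not_closed :
  infinite_set (~` F) -> ~ closed (range collapse).
Proof.
move=> infF cl.
have : closure (range collapse) (None, true).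
  move=> U [[A B] /= [/nbhs_NmaxN[_ finA] /nbhs_singleton B1] ABU].
  have [n [nF An]] : (~` F `&` (Some @^-1` A)) !=set0.
    apply: contrapT => /set0P/negP; rewrite negbK => /eqP FA0; apply: infF.
    by apply: sub_finite_set finA; apply/disjoints_subset.
  exists (Some n, true); split; last exact: ABU.
  have En : E_set FF F (Some n, true) by right; split => //; exists n.
  by exists (SigSub (mem_set En)).
move=> /cl[x _]; rewrite /collapse; case xb : (_ : P).2 => // -[].
by have [n _ ->] := E_highP xb.
Qed.

Lemma collapse_continuous : continuous collapse.
Proof.
apply/continuousP => U _; apply: E_open => x y Ix Iy /=.
by have -> : collapse y = collapse x by apply/collapse_eq; right.
Qed.

Lemma E_not_AH_complete :
  infinite_set (~` F) -> ~ AH_complete T.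
Proof.
move=> infF AH.
pose f : {multiplicative T -> Y} :=
  HB.pack collapse (isMultiplicative.Build T Y collapse collapseM).
exact: (collapse_range_not_closed infF (AH _ f collapse_continuous)).
Qed.

Lemma rees_E_not_H_complete (hI : is_ideal (I_set FF F)) :
  infinite_set (~` F) -> ~ H_complete (rees_quotient hI).
Proof.
move=> infF Hc; apply: (collapse_range_not_closed infF).
pose Q := rees_quotient hI.
pose g (q : Q) : Y := collapse (repr q).
have gpi x : g (\pi_Q%qT x) = collapse x.
  apply/collapse_eq.
  by apply/(rees_piP hI); exact: reprK.
have gM : {morph g : p q / p * q}.
  move=> p q; rewrite -[p]reprK -[q]reprK.
  rewrite (_ : (_ * _) = \pi_Q%qT (repr p * repr q)); last exact: rees_pi_mul.
  by rewrite !gpi collapseM.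
pose f : {multiplicative Q -> Y} :=
  HB.pack g (isMultiplicative.Build Q Y g gM).
have <- : range f = range collapse.
  apply/seteqP; split => _ [x _ <-]; first by exists (repr x).
  by exists (\pi_Q%qT x) => //; exact: gpi.
apply: Hc; split.
- move=> p q /collapse_eq/(rees_piP hI).
  by rewrite !reprK.
- by apply/continuousP => U _; exact: rees_E_discrete.
- move=> U _.
  (* [r] is the identity on [range f]; it is not continuous at (oo, true), but
     that point is outside the preimage of [range f]. *)
  pose r (y : Y) : Y := if y.2 then y else (None, false).
  have rf q : r (f q) = f q.
    by rewrite /r /f /= /g /collapse; case: (_ : P).2.
  exists (r @^-1` (f @` U)); last first.
    apply/seteqP; split => [_ [q Uq <-]|_ [[q _ <-]]] /=; last by rewrite rf.
    by split; [exists q|rewrite rf; exists q].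
  rewrite openE => -[a b]; rewrite /interior /r /=; case: b => /=.
    move=> fa; have [n an] : exists n, a = Some n.
      have [q _] := fa; rewrite /= /g /collapse.
      case xb : ((\val (repr q) : P).2) => // -[<-].
      by have [n _ ->] := E_highP xb; exists n.
    rewrite {}an in fa *.
    by apply: filterS (nbhs_NmaxE2S _ n true) => _ -> /=.
  (* On the open lower layer [r] is constant, so the whole layer lies in the preimage. *)
  move=> fN; exists ([set: Nmax frechet_free_filter], [set false]).
    by split; [exact: filterT|exact: nbhs_E2].
  by move=> [c d] /= [_ ->].
Qed.
End SemilatticeE.

Theorem theorem5 (FF : free_filter posnat) (F : set posnat)
    (FF_F : FF F) (F_coinf : infinite_set (~` F)) :
  [/\ closed (E_set FF F) /\ H_complete (subsemilattice_type (E FF F)),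
      clopen (I_set FF F) /\
      (exists hI : is_ideal (I_set FF F),
         discrete (rees_quotient hI) /\ ~ H_complete (rees_quotient hI)) &
      ~ AH_complete (subsemilattice_type (E FF F))].
Proof.
split; first by split; [exact: E_set_closed|exact: E_H_complete].
  split; first exact: I_set_clopen.
  exists (I_set_ideal FF F).
  by split; [exact: rees_E_discrete|exact: rees_E_not_H_complete].
exact: E_not_AH_complete.
Qed.
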